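(* Let $f:\mathbb{R}^d\to\mathbb{R}$ be twice differentiable with $L$-Lipschitz gradient and $M$-Lipschitz Hessian, uniformly bounded below by $\bar f$. Let $\delta\in(0,1)$. Run the algorithm described in the context with tolerances $\epsilon_g,\epsilon_H>0$ and upper bound $\alpha$ on negative curvature stepsizes, where the inexact oracles satisfy at every iteration $k$ $$\|g_k-\nabla f(x_k)\|\le \tfrac13\max\{\epsilon_g,\|g_k\|\},\qquad \|H_k-\nabla^2 f(x_k)\|\le \tfrac29\epsilon_H,\qquad |\hat\lambda_k-\lambda_{\min}(H_k)|\le \tfrac19\epsilon_H .$$ Then, with probability at least $1-\delta$, the algorithm terminates within at most $$n = 2\,\frac{f(x_0)-\bar f}{R_\epsilon}+BK$$ iterations, where $$R_\epsilon=\min\left(\frac{\epsilon_g^2}{6L},\frac{2\epsilon_H^3}{9M^2}\right),\qquad B=1+\frac{18\alpha L}{M\epsilon_g},\qquad C=2304\,\frac{M^2\alpha^2\epsilon_g^2}{\epsilon_H^6},$$ $$K=C\max\left\{\log\left(\frac1\delta\right),\ \log\left(4\,\frac{f(x_0)-\bar f}{R_\epsilon}\right),\ 2\log(2BC),\ 1\right\}.$$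
   Context: Norms are the Euclidean norm for vectors and the spectral norm for matrices; Lipschitz continuity of the Hessian is with respect to the spectral norm. $\log$ is the natural logarithm. Oracles: at the iterate $x_k$ the algorithm receives an approximate gradient $g_k\in\mathbb{R}^d$ and, if requested, a symmetric approximate Hessian $H_k\in\mathbb{R}^{d\times d}$ together with a unit vector $\hat p_k$ (approximate minimum eigenvector of $H_k$) and the value $\hat\lambda_k:=\hat p_k^T H_k\hat p_k$. The oracle outputs may themselves be random. Algorithm: inputs are $\epsilon_g,\epsilon_H>0$, Lipschitz constants $L,M>0$, a number $\alpha\in[\epsilon_H,L]$, and a (deterministic) $x_0\in\mathbb{R}^d$. For $k=0,1,2,\dots$: (i) if $\|g_k\|>\epsilon_g$, set $x_{k+1}=x_k-\frac1L g_k$ (gradient step); (ii) else if $\hat\lambda_k<-\epsilon_H$, choose $\alpha_k\in[\epsilon_H,\min(\alpha,|\hat\lambda_k|)]$, then draw $\sigma_k\in\{+1,-1\}$ with probability $\frac12$ each, and set $x_{k+1}=x_k+\frac{2\alpha_k}{M}\sigma_k\hat p_k$ (negative curvature step); (iii) else terminate and return $x_k$. The draw $\sigma_k$ is independent of everything generated before it: all $\sigma_i$ with $i<k$, and all $x_i,g_i,H_i,\hat p_i,\hat\lambda_i,\alpha_i$ with $i\le k$. *)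

(* Defs.v *)
From HB Require Import structures.
From mathcomp Require Import all_boot all_order all_algebra.
From mathcomp Require Import all_classical all_reals all_analysis.

Set Implicit Arguments.
Unset Strict Implicit.
Unset Printing Implicit Defensive.

Import Order.TTheory GRing.Theory Num.Theory.
Import numFieldNormedType.Exports.

Local Open Scope classical_set_scope.
Local Open Scope ring_scope.

Section LinearAlgebra.
Context {R : realType} {d : nat}.

(* The norm `|v| that the library puts on matrices is the sup norm. *)
Definition norm2 (v : 'cV[R]_d) : R := Num.sqrt (\sum_i v i 0 ^+ 2).

Definition spectral_norm (A : 'M[R]_d) : R :=
  sup [set norm2 (A *m v) | v in [set v | norm2 v <= 1]].

Definition symmetric_mx (A : 'M[R]_d) : Prop := A^T = A.

(* Meaningful for symmetric A and 0 < d, where the set of eigenvalues is finite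
   and nonempty, so that the infimum is a minimum. *)
Definition lambda_min (A : 'M[R]_d) : R := inf [set a | eigenvalue A a].

End LinearAlgebra.

Section Smoothness.
Context {R : realType} {d : nat}.
Implicit Types (f : 'cV[R]_d -> R) (x : 'cV[R]_d).

Definition gradient f x : 'cV[R]_d := \col_i 'd f x (delta_mx i 0).

Definition hessian f x : 'M[R]_d :=
  \matrix_(i, j) ('d (gradient f) x (delta_mx j 0) : 'cV[R]_d) i 0.

(* Frechet differentiability does not depend on the norm chosen on 'cV[R]_d. *)
Definition twice_differentiable f : Prop :=
  (forall x, differentiable f x) /\ (forall x, differentiable (gradient f) x).

Definition lipschitz_gradient f (L : R) : Prop :=
  forall x y, norm2 (gradient f x - gradient f y) <= L * norm2 (x - y).

Definition lipschitz_hessian f (M : R) : Prop :=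
  forall x y, spectral_norm (hessian f x - hessian f y) <= M * norm2 (x - y).

End Smoothness.

(* All the quantities attached to iteration k, as functions on the sample space
   T. They are total for convenience: the values at iterations after
   termination, and those of Hk, pk, ak at iterations where the Hessian is not
   requested, are not constrained by the algorithm or by the oracle accuracy. *)
Record run (R : realType) (d : nat) (T : Type) := Run {
  xk : nat -> T -> 'cV[R]_d ;
  gk : nat -> T -> 'cV[R]_d ;
  Hk : nat -> T -> 'M[R]_d ;
  pk : nat -> T -> 'cV[R]_d ;
  ak : nat -> T -> R ;
  sk : nat -> T -> R
}.

Section Algorithm.
Context {R : realType} {d : nat} {T : Type} (X : run R d T).
Variables (eps_g eps_H : R).

Definition lambda_hat (k : nat) (w : T) : R :=
  ((pk X k w)^T *m Hk X k w *m pk X k w) 0 0.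

Definition gradient_case (k : nat) (w : T) : Prop := eps_g < norm2 (gk X k w).

Definition curvature_case (k : nat) (w : T) : Prop :=
  ~ gradient_case k w /\ lambda_hat k w < - eps_H.

Definition stop_case (k : nat) (w : T) : Prop :=
  ~ gradient_case k w /\ ~ lambda_hat k w < - eps_H.

Definition reached (k : nat) (w : T) : Prop :=
  forall i, (i < k)%N -> ~ stop_case i w.

(* Exactly k updates of the iterate are made, and xk X k w is returned. *)
Definition terminates_at (k : nat) (w : T) : Prop :=
  reached k w /\ stop_case k w.

Definition follows_algorithm (L M alpha : R) (x0 : 'cV[R]_d) : Prop :=
  (forall w, xk X 0 w = x0) /\
  (forall k w, reached k w -> gradient_case k w ->
     xk X k.+1 w = xk X k w - L^-1 *: gk X k w) /\
  (forall k w, reached k w -> curvature_case k w ->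
     eps_H <= ak X k w <= Num.min alpha `|lambda_hat k w| /\
     xk X k.+1 w = xk X k w + (2 * ak X k w / M * sk X k w) *: pk X k w).

Definition accurate_oracles (f : 'cV[R]_d -> R) : Prop :=
  (forall k w, reached k w ->
     norm2 (gk X k w - gradient f (xk X k w))
       <= 3^-1 * Num.max eps_g (norm2 (gk X k w))) /\
  (forall k w, reached k w -> ~ gradient_case k w ->
     [/\ symmetric_mx (Hk X k w),
         spectral_norm (Hk X k w - hessian f (xk X k w)) <= 2 / 9 * eps_H,
         norm2 (pk X k w) = 1
       & `|lambda_hat k w - lambda_min (Hk X k w)| <= 9^-1 * eps_H]).

(* The real random variables determined at iteration k before sk X k is drawn;
   vectors and matrices enter through their entries. *)
Inductive predraw_var (k : nat) : (T -> R) -> Prop :=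
| predraw_x i : predraw_var k (fun w => xk X k w i 0)
| predraw_g i : predraw_var k (fun w => gk X k w i 0)
| predraw_H i j : predraw_var k (fun w => Hk X k w i j)
| predraw_p i : predraw_var k (fun w => pk X k w i 0)
| predraw_lambda : predraw_var k (lambda_hat k)
| predraw_a : predraw_var k (ak X k).

Definition past_var (k : nat) (Y : T -> R) : Prop :=
  (exists2 i, (i < k)%N & Y = sk X i) \/
  (exists2 i, (i <= k)%N & predraw_var i Y).

Definition past (k : nat) : set (set T) :=
  <<s [set A | exists Y (B : set R),
         [/\ past_var k Y, measurable B & A = Y @^-1` B]] >>.

End Algorithm.

Section Randomness.
Context {R : realType} {d : nat} {disp : measure_display}
  {T : measurableType disp}.

Definition measurable_run (X : run R d T) : Prop :=
  (forall k Y, predraw_var X k Y -> measurable_fun setT Y) /\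
  (forall k, measurable_fun setT (sk X k)).

Definition fair_signs (P : probability T R) (X : run R d T) : Prop :=
  (forall k w, sk X k w = 1 \/ sk X k w = -1) /\
  (forall k, P [set w | sk X k w = 1] = (2^-1)%:E) /\
  (forall k, P [set w | sk X k w = -1] = (2^-1)%:E).

Definition signs_independent_of_past (P : probability T R) (X : run R d T) :
    Prop :=
  forall k (A : set T) (B : set R), past X k A -> measurable B ->
    P (A `&` sk X k @^-1` B) = (P A * P (sk X k @^-1` B))%E.

End Randomness.

Section Constants.
Context {R : realType}.
Variables (eps_g eps_H L M alpha delta Delta : R).

Definition R_eps : R :=
  Num.min (eps_g ^+ 2 / (6 * L)) (2 * eps_H ^+ 3 / (9 * M ^+ 2)).

Definition B_const : R := 1 + 18 * alpha * L / (M * eps_g).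

Definition C_const : R := 2304 * (M ^+ 2 * alpha ^+ 2 * eps_g ^+ 2 / eps_H ^+ 6).

(* Delta stands for f x0 - fbar. If Delta = 0 the second logarithm is -oo by
   convention and ln 0 = 0 in the library; the maximum with 1 makes both
   readings agree. *)
Definition K_const : R :=
  C_const * Num.max (ln (1 / delta))
              (Num.max (ln (4 * (Delta / R_eps)))
                (Num.max (2 * ln (2 * B_const * C_const)) 1)).

Definition iteration_bound : R := 2 * (Delta / R_eps) + B_const * K_const.

End Constants.

(* Main.v *)
(**
  A gradient step decreases [f] by at least [Rg = eps_g^2 / (6 L)].  By a
  second-order Taylor expansion, a curvature step decreases it by at least
  [Rh = 2 eps_H^3 / (9 M^2)], up to the term [2 a / M * sigma * <grad f x, p>],
  whose sign is a fair coin and whose size is at most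
  [c = 8 alpha eps_g / (3 M)].  If [Z] is the sum of these terms and [m] the
  number of curvature steps among the first [N], then
  [Rg (N - m) + Rh m <= f x0 - fbar + Z].  Hence a run that is longer than the
  bound has [m >= K] and [Z >= m Rh / 2].  Since [cosh u <= exp (u^2 / 2)],
  [exp (t Z - t^2 c^2 m / 2)] is a supermartingale in [N]; with the tilt
  [t = Rh / (2 c^2)], which does not depend on [m], it is at least
  [exp (2 K / C) >= 1 / delta] on such runs, so Markov's inequality concludes
  without a union bound over the random number of curvature steps.
*)
Require Import Defs.
From HB Require Import structures.
From mathcomp Require Import all_boot all_order all_algebra.
From mathcomp Require Import all_classical all_reals all_analysis.
From mathcomp Require Import measurable_realfun ring lra.

Import Order.TTheory GRing.Theory Num.Theory.
Import numFieldNormedType.Exports.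

Local Open Scope classical_set_scope.
Local Open Scope ring_scope.

(** * Taylor bounds *)

Section Euclidean.
Context {R : realType} {d : nat}.
Implicit Types (u v w : 'cV[R]_d) (A : 'M[R]_d).

Definition dotp u v : R := \sum_i u i 0 * v i 0.

Lemma dotpC u v : dotp u v = dotp v u.
Proof. by apply: eq_bigr => i _; rewrite mulrC. Qed.

Lemma dotpDl u v w : dotp (u + v) w = dotp u w + dotp v w.
Proof. by rewrite -big_split; apply: eq_bigr => i _; rewrite mxE mulrDl. Qed.

Lemma dotpZl a u v : dotp (a *: u) v = a * dotp u v.
Proof. by rewrite mulr_sumr; apply: eq_bigr => i _; rewrite mxE mulrA. Qed.

Lemma dotpNl u v : dotp (- u) v = - dotp u v.
Proof. by rewrite -scaleN1r dotpZl mulN1r. Qed.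

Lemma dotpBl u v w : dotp (u - v) w = dotp u w - dotp v w.
Proof. by rewrite dotpDl dotpNl. Qed.

Lemma dotpDr u v w : dotp u (v + w) = dotp u v + dotp u w.
Proof. by rewrite dotpC dotpDl !(dotpC u). Qed.

Lemma dotpZr a u v : dotp u (a *: v) = a * dotp u v.
Proof. by rewrite dotpC dotpZl dotpC. Qed.

Lemma dotpNr u v : dotp u (- v) = - dotp u v.
Proof. by rewrite dotpC dotpNl dotpC. Qed.

Lemma dotpBr u v w : dotp u (v - w) = dotp u v - dotp u w.
Proof. by rewrite dotpDr dotpNr. Qed.

Lemma norm2_ge0 v : 0 <= norm2 v.
Proof. exact: sqrtr_ge0. Qed.

Lemma sqr_norm2 v : norm2 v ^+ 2 = dotp v v.
Proof.
rewrite sqr_sqrtr; first by apply: eq_bigr => i _; rewrite expr2.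
by apply: sumr_ge0 => i _; exact: sqr_ge0.
Qed.

Lemma norm2_eq0 v : norm2 v = 0 -> v = 0.
Proof.
move=> v0; apply/matrixP => i j; rewrite ord1 mxE.
have := sqr_norm2 v; rewrite v0 expr0n /= => /esym/eqP.
rewrite psumr_eq0 => [/allP/(_ i)|k _]; last by rewrite -expr2 sqr_ge0.
rewrite mem_index_enum => /(_ isT)/implyP/(_ isT).
by rewrite mulf_eq0 orbb => /eqP.
Qed.

Lemma norm2N v : norm2 (- v) = norm2 v.
Proof. by congr Num.sqrt; apply: eq_bigr => i _; rewrite mxE sqrrN. Qed.

Lemma norm2Z a v : norm2 (a *: v) = `|a| * norm2 v.
Proof.
rewrite -sqrtr_sqr /norm2 -sqrtrM ?sqr_ge0//; congr Num.sqrt.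
by rewrite mulr_sumr; apply: eq_bigr => i _; rewrite mxE exprMn.
Qed.

(** Cauchy-Schwarz: with [a], [b] the norms and [c] the inner product, the squared norm of
    [b u - a v] equals [2ab(ab - c)]. Dividing by [ab] is why zero vectors are treated first. *)
Lemma dotp_le_norm2 u v : dotp u v <= norm2 u * norm2 v.
Proof.
have [u0|u0] := eqVneq (norm2 u) 0.
  by rewrite u0 mul0r (norm2_eq0 _ u0) -(scale0r 0) dotpZl mul0r.
have [v0|v0] := eqVneq (norm2 v) 0.
  by rewrite v0 mulr0 (norm2_eq0 _ v0) -(scale0r 0) dotpZr mul0r.
have := sqr_ge0 (norm2 (norm2 v *: u - norm2 u *: v)).
rewrite sqr_norm2 !(dotpDl, dotpDr, dotpNl, dotpNr, dotpZl, dotpZr).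
rewrite -!sqr_norm2 (dotpC v u).
set a := norm2 u in u0 *; set b := norm2 v in v0 *; set c := dotp u v => h.
have ab : 0 < a * b by rewrite mulr_gt0// lt_def ?u0 ?v0 norm2_ge0.
rewrite -(ler_pM2l ab); lra.
Qed.

Lemma abs_dotp_le_norm2 u v : `|dotp u v| <= norm2 u * norm2 v.
Proof.
by rewrite ler_norml lerNl -dotpNl -(norm2N u) !dotp_le_norm2 (norm2N u)
  dotp_le_norm2.
Qed.

Lemma norm2D u v : norm2 (u + v) <= norm2 u + norm2 v.
Proof.
rewrite -(ler_pXn2r (ltn0Sn 1)) ?nnegrE ?addr_ge0 ?norm2_ge0//.
rewrite sqr_norm2 dotpDl !dotpDr (dotpC v u) -!sqr_norm2.
have := dotp_le_norm2 u v; lra.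
Qed.

(** A supremum dominates the members of a set only if the set is bounded above; by Cauchy-Schwarz on
    each row, the Frobenius norm of [A] is such a bound. *)
Lemma norm2_mulmx_le_spectral A v :
  norm2 v <= 1 -> norm2 (A *m v) <= spectral_norm A.
Proof.
move=> v1; apply: ub_le_sup; last by exists v.
exists (Num.sqrt (\sum_i norm2 (\col_j A i j) ^+ 2)) => _ [u /= u1 <-].
apply: ler_wsqrtr; apply: ler_sum => i _.
have -> : (A *m u) i 0 = dotp (\col_j A i j) u.
  by rewrite mxE; apply: eq_bigr => j _; rewrite mxE.
rewrite -real_normK ?num_real// ler_pXn2r ?nnegrE ?norm2_ge0//.
by rewrite (le_trans (abs_dotp_le_norm2 _ _))// ler_piMr ?norm2_ge0.
Qed.

Lemma abs_quadratic_le_spectral A v :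
  norm2 v = 1 -> `|dotp v (A *m v)| <= spectral_norm A.
Proof.
move=> v1; rewrite (le_trans (abs_dotp_le_norm2 _ _))// v1 mul1r.
by rewrite norm2_mulmx_le_spectral// v1.
Qed.

Lemma dotp_continuous v : continuous (fun u => dotp u v).
Proof.
apply: continuous_big => [|i _ u]; first exact: add_continuous.
apply: (@cvgMr_tmp R _ (nbhs u) _ (fun u : 'cV[R]_d => u i 0)).
exact: coord_continuous.
Qed.

End Euclidean.

(** [g - h] has nonpositive derivative, hence is nonincreasing on [[0, t]]. This takes the place of
    integral remainders: the Taylor bounds compare derivatives with those of a polynomial. *)
Lemma derive_le_le {R : realType} (g g' h h' : R -> R) :
  (forall t : R, is_derive t 1 g (g' t)) ->
  (forall t : R, is_derive t 1 h (h' t)) ->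
  g 0 <= h 0 -> (forall t, 0 <= t -> g' t <= h' t) ->
  forall t, 0 <= t -> g t <= h t.
Proof.
move=> dg dh gh0 gh' t t0.
have dgh (s : R) : is_derive s 1 (g - h) (g' s - h' s) by exact: is_deriveB.
suff : g t - h t <= g 0 - h 0 by lra.
apply: (@ler0_derive1_le_cc R (g - h) 0 t); rewrite ?in_itv/= ?lexx ?t0//.
- move=> s; rewrite in_itv /= => /andP[/ltW s0 _].
  by rewrite derive1E derive_val subr_le0 gh'.
- apply: continuous_subspaceT => s.
  by apply/differentiable_continuous/derivable1_diffP.
Qed.

Section Taylor.
Context {R : realType} {d : nat}.
Variable f : 'cV[R]_d -> R.
Implicit Types (x v : 'cV[R]_d) (t : R).
Context (hf : twice_differentiable f).

Lemma diff_gradient x v : 'd f x v = dotp (gradient f x) v.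
Proof.
rewrite [in LHS](matrix_sum_delta v) linear_sum; apply: eq_bigr => i _.
by rewrite big_ord1 linearZ mxE mulrC.
Qed.

Lemma diff_hessian x v : 'd (gradient f) x v = hessian f x *m v.
Proof.
rewrite [in LHS](matrix_sum_delta v) linear_sum; apply/matrixP => i j.
rewrite ord1 summxE mxE; apply: eq_bigr => k _.
by rewrite big_ord1 linearZ !mxE mulrC.
Qed.

Lemma is_diff_dotpl v (y : 'cV[R]_d) :
  is_diff y (fun u => dotp u v) (fun u => dotp u v).
Proof.
have lin : linear (fun u => dotp u v : R^o).
  by move=> a u w; rewrite dotpDl dotpZl.
pose lM := GRing.isLinear.Build _ _ _ _ _ lin.
pose L : {linear 'cV[R]_d -> R^o} := HB.pack (fun u => dotp u v) lM.
have Lc : continuous L.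
  by move=> u; exact: dotp_continuous.
have -> : (fun u => dotp u v) = L by [].
by apply: DiffDef; [exact: linear_differentiable|rewrite diff_lin].
Qed.

Lemma is_diff_line x v t :
  is_diff t (fun t => x + t *: v) (fun t => t *: v).
Proof.
pose g : R -> 'cV[R]_d := *:%R^~ v.
have dg : is_diff t g g := is_diff_scalel t v.
have dc : is_diff t (cst x : R -> 'cV[R]_d) 0 := is_diff_cst x t.
have := is_diffD dc dg.
by rewrite add0r.
Qed.

Lemma is_derive_line x v t :
  is_derive t 1 (fun t => f (x + t *: v)) (dotp (gradient f (x + t *: v)) v).
Proof.
have dfl : is_diff t (f \o (fun t => x + t *: v))
    ('d f (x + t *: v) \o (fun t => t *: v)).
  apply: is_diff_comp; first exact: is_diff_line.
  by apply: differentiableP; exact: (proj1 hf).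
apply: DeriveDef; first exact/diff_derivable/ex_diff.
rewrite deriveE; last exact/ex_diff.
by rewrite diff_val /= scale1r diff_gradient.
Qed.

Lemma is_derive_gradient_line x v t :
  is_derive t 1 (fun t => dotp (gradient f (x + t *: v)) v)
    (dotp v (hessian f (x + t *: v) *m v)).
Proof.
have dfl : is_diff t
    ((fun u => dotp u v) \o (gradient f \o (fun t => x + t *: v)))
    ((fun u => dotp u v)
       \o ('d (gradient f) (x + t *: v) \o (fun t => t *: v))).
  apply: is_diff_comp.
    apply: is_diff_comp; first exact: is_diff_line.
    by apply: differentiableP; exact: (proj2 hf).
  exact: is_diff_dotpl.
apply: DeriveDef; first exact/diff_derivable/ex_diff.
rewrite deriveE; last exact/ex_diff.
by rewrite diff_val /= scale1r diff_hessian dotpC.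
Qed.

(** By Cauchy-Schwarz and the Lipschitz bound, the slope of [f] along [v] at time [t] exceeds the
    initial one by at most [L t |v|^2]; compare primitives at [t = 1]. *)
Lemma descent_lemma (L : R) x v : lipschitz_gradient f L ->
  f (x + v) <= f x + dotp (gradient f x) v + L / 2 * norm2 v ^+ 2.
Proof.
move=> hL.
have := derive_le_le (fun t => f (x + t *: v))
  (fun t => dotp (gradient f (x + t *: v)) v)
  (fun t => f x + t * dotp (gradient f x) v + L / 2 * norm2 v ^+ 2 * t ^+ 2)
  (fun t => dotp (gradient f x) v + L * norm2 v ^+ 2 * t)
  (is_derive_line x v).
have dh (t : R) : is_derive t 1
    (fun t => f x + t * dotp (gradient f x) v + L / 2 * norm2 v ^+ 2 * t ^+ 2)
    (dotp (gradient f x) v + L * norm2 v ^+ 2 * t).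
  by apply: is_derive_eq; rewrite /GRing.scale /=; field.
move=> /(_ dh); rewrite scale0r addr0 mul0r expr0n mulr0 !addr0.
move=> /(_ (lexx _)) /(_ _ 1 ler01).
rewrite scale1r mul1r expr1n mulr1; apply=> t t0.
rewrite -lerBlDl -dotpBl (le_trans (dotp_le_norm2 _ _))//.
rewrite (le_trans (ler_wpM2r (norm2_ge0 _) (hL _ _)))//.
by rewrite addrAC subrr add0r norm2Z ger0_norm// le_eqVlt; apply/orP; left;
  apply/eqP; ring.
Qed.

(** At distance [r] along the unit vector [p], the second derivative exceeds its value at [x] by at
    most [M r]. Two nested comparisons integrate this twice. *)
Lemma taylor2_le (M : R) x p t : lipschitz_hessian f M -> norm2 p = 1 ->
  0 <= t ->
  f (x + t *: p) <= f x + t * dotp (gradient f x) p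
    + t ^+ 2 / 2 * dotp p (hessian f x *m p) + M / 6 * t ^+ 3.
Proof.
move=> hM p1 t0.
have dq (s : R) : is_derive s 1
    (fun s => dotp (gradient f x) p + s * dotp p (hessian f x *m p)
       + M / 2 * s ^+ 2)
    (dotp p (hessian f x *m p) + M * s).
  by apply: is_derive_eq; rewrite /GRing.scale /=; field.
have dc (s : R) : is_derive s 1
    (fun s => f x + s * dotp (gradient f x) p
       + s ^+ 2 / 2 * dotp p (hessian f x *m p) + M / 6 * s ^+ 3)
    (dotp (gradient f x) p + s * dotp p (hessian f x *m p) + M / 2 * s ^+ 2).
  by apply: is_derive_eq; rewrite /GRing.scale /=; field.
apply: (derive_le_le _ _ _ _ (is_derive_line x p) dc) => //.
  by rewrite scale0r !expr0n /= !(mul0r, mulr0, addr0).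
move=> {t0}s s0.
apply: (derive_le_le _ _ _ _ (is_derive_gradient_line x p) dq) => //.
  by rewrite scale0r !expr0n /= !(mul0r, mulr0, addr0).
move=> {s0}r r0; rewrite -lerBlDl -dotpBr -mulmxBl.
rewrite (le_trans (ler_norm _))//.
rewrite (le_trans (abs_quadratic_le_spectral _ _ p1))//.
rewrite (le_trans (hM _ _))// addrAC subrr add0r norm2Z p1 mulr1.
by rewrite ger0_norm.
Qed.

(** Here the oracle error is relative, at most [|g| / 3], so the linear term gains at least
    [2/3 |g|^2 / L] and the quadratic one costs [1/2 |g|^2 / L]: [1/6] remains. *)
Lemma gradient_step_le (L eps : R) x g : 0 < L -> 0 < eps ->
  lipschitz_gradient f L -> eps < norm2 g ->
  norm2 (g - gradient f x) <= 3^-1 * Num.max eps (norm2 g) ->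
  f (x - L^-1 *: g) <= f x - eps ^+ 2 / (6 * L).
Proof.
move=> L0 eps0 hL epsg; rewrite (max_r (ltW epsg)) => gerr.
have := descent_lemma L x (- (L^-1 *: g)) hL.
have L1 : 0 <= L^-1 by rewrite invr_ge0 ltW.
rewrite norm2N norm2Z dotpNr dotpZr (ger0_norm L1) => /le_trans; apply.
have gg : dotp (gradient f x) g = norm2 g ^+ 2 - dotp (g - gradient f x) g.
  by rewrite dotpBl -sqr_norm2 opprB addrC subrK.
have : dotp (g - gradient f x) g <= 3^-1 * norm2 g ^+ 2.
  rewrite (le_trans (dotp_le_norm2 _ _))// expr2 mulrA ler_wpM2r//.
  exact: norm2_ge0.
have : eps ^+ 2 <= norm2 g ^+ 2.
  by rewrite ler_pXn2r ?nnegrE ?norm2_ge0 ?ltW.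
rewrite gg; set G := norm2 g; set e := dotp (g - _) _ => h1 h2.
rewrite -(ler_pM2r L0).
have -> : (f x - L^-1 * (G ^+ 2 - e) + L / 2 * (L^-1 * G) ^+ 2) * L
  = f x * L - (G ^+ 2 - e) + G ^+ 2 / 2 by field; lra.
have -> : (f x - eps ^+ 2 / (6 * L)) * L = f x * L - eps ^+ 2 / 6 by field; lra.
lra.
Qed.

(** [4/3 = 1 + 1/3]. This controls the random first-order term of a curvature step. *)
Lemma norm2_gradient_le (eps : R) x g : norm2 g <= eps ->
  norm2 (g - gradient f x) <= 3^-1 * Num.max eps (norm2 g) ->
  norm2 (gradient f x) <= 4 / 3 * eps.
Proof.
move=> geps; rewrite (max_l geps) => gerr.
have := norm2D g (- (g - gradient f x)).
rewrite norm2N opprB addrC subrK; lra.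
Qed.

(** The sign is absorbed into the direction, which leaves the quadratic form unchanged. That form is
    at most [- a + 2/9 eps <= - 7/9 a] at the true Hessian. *)
Lemma curvature_step_le (M eps a s : R) x p (H : 'M[R]_d) : 0 < M -> 0 < eps ->
  lipschitz_hessian f M -> norm2 p = 1 ->
  spectral_norm (H - hessian f x) <= 2 / 9 * eps ->
  dotp p (H *m p) < - eps ->
  eps <= a <= `|dotp p (H *m p)| -> s = 1 \/ s = -1 ->
  f (x + (2 * a / M * s) *: p) <=
    f x + 2 * a / M * s * dotp (gradient f x) p - 2 * eps ^+ 3 / (9 * M ^+ 2).
Proof.
move=> M0 eps0 hM p1 Herr Hneg /andP[epsa aH] sE.
have sp1 : norm2 (s *: p) = 1.
  by case: sE => ->; rewrite norm2Z ?normrN normr1 mul1r.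
have a0 : 0 < a by exact: lt_le_trans epsa.
have := taylor2_le M x (s *: p) (2 * a / M) hM sp1.
rewrite scalerA => /(_ _)/le_trans; apply.
  by rewrite divr_ge0 ?mulr_ge0 ?ltW.
have -> : dotp (s *: p) (hessian f x *m (s *: p)) = dotp p (hessian f x *m p).
  rewrite -scalemxAr dotpZl dotpZr.
  by case: sE => ->; rewrite !(mulN1r, mul1r, opprK).
rewrite dotpZr.
have := abs_quadratic_le_spectral (H - hessian f x) p p1.
rewrite mulmxBl dotpBr => /le_trans/(_ Herr).
rewrite ler_norml => /andP[+ _].
rewrite ltr0_norm in aH; last by lra.
set q := dotp p (hessian f x *m p); set h := dotp p (H *m p) in aH Hneg *.
move=> hq.
have qa : q <= - (7 / 9 * a) by lra.
have ea : eps ^+ 3 <= a ^+ 3 by apply: lerXn2r; rewrite ?nnegrE// ltW.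
have : (2 * a / M) ^+ 2 / 2 * q <= (2 * a / M) ^+ 2 / 2 * - (7 / 9 * a).
  by rewrite ler_wpM2l// divr_ge0// sqr_ge0.
(* In units of [a^3 / M^2] the quadratic term is [-14/9] and the cubic one [12/9], which leaves
   [-2/9]. *)
have -> : (2 * a / M) ^+ 2 / 2 * - (7 / 9 * a) =
  - (2 * a ^+ 3 / (9 * M ^+ 2)) - M / 6 * (2 * a / M) ^+ 3 by field; lra.
have : 2 * eps ^+ 3 / (9 * M ^+ 2) <= 2 * a ^+ 3 / (9 * M ^+ 2).
  by rewrite ler_pM2r ?invr_gt0 ?mulr_gt0 ?exprn_gt0// ler_pM2l.
rewrite -!(mulrA _ s); lra.
Qed.

End Taylor.

(** * Exponential supermartingales of fair signs *)

(** By evenness take [u >= 0]. The function [2 cosh t exp(- t^2 / 2)] equals 2 at 0 and is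
    nonincreasing because [sinh t <= t cosh t], itself a comparison of derivatives. *)
Lemma cosh_le_expR_sqr {R : realType} (u : R) :
  (expR u + expR (- u)) / 2 <= expR (u ^+ 2 / 2).
Proof.
wlog u0 : u / 0 <= u => [hw|].
  have [|/ltW u0] := leP 0 u; first exact: hw.
  by have := hw (- u); rewrite opprK sqrrN addrC; apply; rewrite oppr_ge0.
have dN (t : R) : is_derive t 1 (fun t => expR (- t)) (- expR (- t)).
  apply: is_derive_eq; rewrite /GRing.scale /=; ring.
have sinh_le (t : R) : 0 <= t ->
    expR t - expR (- t) <= t * (expR t + expR (- t)).
  move=> t0; refine (derive_le_le (fun t => expR t - expR (- t))
    (fun t => expR t + expR (- t)) (fun t => t * (expR t + expR (- t)))
    (fun t => expR t + expR (- t) + t * (expR t - expR (- t))) _ _ _ _ t t0).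
  - by move=> s; apply: is_derive_eq; rewrite /GRing.scale /=; ring.
  - by move=> s; apply: is_derive_eq; rewrite /GRing.scale /=; ring.
  - by rewrite oppr0 subrr mul0r.
  - move=> s s0; rewrite lerDl mulr_ge0// subr_ge0 ler_expR; lra.
pose k (t : R) := (expR t + expR (- t)) * expR (- (t ^+ 2 / 2)).
suff : k u <= 2.
  rewrite /k (expRN (_ / 2)) ler_pdivrMr ?expR_gt0//; lra.
refine (derive_le_le k
  (fun t => (expR t - expR (- t) - t * (expR t + expR (- t)))
            * expR (- (t ^+ 2 / 2))) (fun=> 2) (fun=> 0) _ _ _ _ u u0).
- move=> t.
  have dS : is_derive t 1 (fun t : R => expR (- (t ^+ 2 / 2)))
      (- t * expR (- (t ^+ 2 / 2))).
    by apply: is_derive_eq; rewrite /GRing.scale /=; field.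
  by rewrite /k; apply: is_derive_eq; rewrite /GRing.scale /=; ring.
- rewrite /k expr2 !mul0r oppr0 expR0 mulr1; lra.
- by move=> t t0; rewrite mulr_le0_ge0 ?expR_ge0// subr_le0 sinh_le.
Qed.

(** * Integration against a fair sign independent of a sigma-algebra *)

Section Integration.
Context {disp : measure_display} {T : measurableType disp} {R : realType}.
Local Open Scope ereal_scope.

(** Split over [D] and its complement: the restricted measure agrees with [mu] inside the first and
    vanishes inside the second. *)
Lemma ge0_integral_mrestr (mu : {measure set T -> \bar R}) (D : set T)
    (mD : measurable D) (F : T -> \bar R) :
  measurable_fun [set: T] F -> (forall x, 0 <= F x) ->
  \int[mrestr mu mD]_x F x = \int[mu]_(x in D) F x.
Proof.
move=> mF F0; rewrite -(setUv D) ge0_integral_setU//; first last.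
- exact/disj_setPCl.
- by rewrite setUv.
- exact: measurableC.
rewrite (eq_measure_integral mu) => [|A mA AD]; last first.
  by rewrite /= /mrestr setIidl.
rewrite [X in _ + X](eq_measure_integral mzero) ?integral_measure_zero ?adde0//.
by move=> A mA AD; rewrite /= /mrestr (disjoints_subset _ _).2// measure0.
Qed.

(** The measures [P (A & D)] and [c P A] coincide on the sigma-algebra generated by [G]. Pushing
    both forward to it along the identity gives equal integrals for every [F] measurable there. *)
Lemma ge0_integral_indep (P : probability T R) (G : set (set T)) (D : set T)
    (c : {nonneg R}%R) (F : T -> \bar R) :
  <<s G >> `<=` measurable -> measurable D ->
  (forall A, <<s G >> A -> P (A `&` D) = P A * c%:num%:E) ->
  measurable_fun (setT : set (g_sigma_algebraType G)) F ->
  (forall x, 0 <= F x) ->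
  \int[P]_(x in D) F x = c%:num%:E * \int[P]_x F x.
Proof.
move=> sG mD ind mF F0.
have mid : measurable_fun setT (idfun : T -> g_sigma_algebraType G).
  by move=> _ B mB; rewrite setTI; exact: sG.
have mFT : measurable_fun (setT : set T) F.
  exact: (measurableT_comp mF mid).
rewrite -(ge0_integral_mrestr _ _ mD)// -ge0_integral_mscale//.
have e (mu : {measure set T -> \bar R}) :
    \int[mu]_x F x =
    \int[pushforward mu (idfun : T -> g_sigma_algebraType G)]_x F x.
  by rewrite (@ge0_integral_pushforward _ _ _ _ _ _ mid).
rewrite !e; apply: eq_measure_integral => A mA _.
change (P (A `&` D) = c%:num%:E * P A).
by rewrite ind// muleC.
Qed.

(** Averaging over the two signs turns the integrand into [W exp(- v) cosh u], and
    [cosh u <= exp(u^2 / 2) <= exp v]. *)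
Lemma ge0_integral_fair_sign_le (P : probability T R) (G : set (set T))
    (s W u v : T -> R) :
  <<s G >> `<=` measurable -> measurable_fun [set: T] s ->
  (forall w, s w = 1 \/ s w = -1)%R ->
  (forall A, <<s G >> A -> P (A `&` s @^-1` [set 1%R]) = P A * (2^-1)%:E) ->
  (forall A, <<s G >> A -> P (A `&` s @^-1` [set (-1)%R]) = P A * (2^-1)%:E) ->
  measurable_fun (setT : set (g_sigma_algebraType G)) W ->
  measurable_fun (setT : set (g_sigma_algebraType G)) u ->
  measurable_fun (setT : set (g_sigma_algebraType G)) v ->
  (forall w, 0 <= W w)%R -> (forall w, u w ^+ 2 <= 2 * v w)%R ->
  \int[P]_w (W w * expR (u w * s w - v w))%:E <= \int[P]_w (W w)%:E.
Proof.
move=> sG ms sE indp indm mW mu mv W0 uv.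
have mid : measurable_fun [set: T] (idfun : T -> g_sigma_algebraType G).
  by move=> _ B mB; rewrite setTI; exact: sG.
have mGT (F : T -> R) : measurable_fun (setT : set (g_sigma_algebraType G)) F ->
    measurable_fun [set: T] F by move=> mF; exact: (measurableT_comp mF mid).
have msD (r : R) : measurable (s @^-1` [set r]).
  by rewrite -[_ @^-1` _]setTI; exact: ms.
have mF (b : R) : measurable_fun (setT : set (g_sigma_algebraType G))
    (fun w => W w * expR (u w * b - v w))%R.
  apply: measurable_funM => //; apply: measurableT_comp => //.
  by apply: measurable_funB => //; apply: measurable_funM.
have F0 b w : (0 <= W w * expR (u w * b - v w))%R by rewrite mulr_ge0 ?expR_ge0.
(* On the event [s = b] the sign becomes a constant, so the integrand is measurable for the past and
   independence applies. *)
have half b : (forall A, <<s G >> A ->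
      P (A `&` s @^-1` [set b]) = P A * (2^-1)%:E) ->
    \int[P]_(w in s @^-1` [set b]) (W w * expR (u w * s w - v w))%:E =
    (2^-1)%:E * \int[P]_w (W w * expR (u w * b - v w))%:E.
  move=> ind.
  have h0 : (0 <= 2^-1 :> R)%R by rewrite invr_ge0.
  rewrite -(ge0_integral_indep P G (s @^-1` [set b]) (NngNum h0))//; last first.
    by move=> w; rewrite lee_fin.
    exact/measurable_EFinP.
  by apply: eq_integral => w; rewrite inE /= => ->.
have mH (b : R) : measurable_fun [set: T]
    (fun w => (2^-1)%:E * (W w * expR (u w * b - v w))%:E).
  by apply: emeasurable_funM => //; apply/measurable_EFinP;
    exact: (mGT _ (mF b)).
have n11 : (1 <> -1 :> R)%R by lra.
have setTE : [set: T] = s @^-1` [set 1%R] `|` s @^-1` [set (-1)%R].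
  by apply/seteqP; split=> // w _; have [] := sE w; [left|right].
rewrite [in leLHS]setTE ge0_integral_setU//; first last.
- apply/disj_setPS => w [/= ->]; exact: n11.
- by move=> w _; rewrite lee_fin.
- apply/measurable_EFinP; apply: measurable_funTS.
  apply: measurable_funM; first exact: mGT.
  apply: measurableT_comp => //; apply: measurable_funB; last exact: mGT.
  by apply: measurable_funM => //; exact: mGT.
rewrite (half _ indp) (half _ indm) -!ge0_integralZl//; first last.
all: try by move=> w _; rewrite lee_fin.
all: try exact/measurable_EFinP/mGT.
rewrite -ge0_integralD//; first last.
all: try by move=> w _; rewrite lee_fin mulr_ge0.
apply: ge0_le_integral => //.
- by move=> w _; rewrite -EFinD lee_fin addr_ge0// mulr_ge0.
- exact: emeasurable_funD.
- exact/measurable_EFinP/mGT.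
move=> w _; rewrite -EFinD lee_fin mulr1 mulrN1 !expRD expRN.
rewrite !mulrA -mulrDl ler_pdivrMr ?expR_gt0//.
have := cosh_le_expR_sqr (u w).
have : (expR (u w ^+ 2 / 2) <= expR (v w))%R.
  by rewrite ler_expR; have := uv w; lra.
move=> /[swap] /le_trans /[apply] h.
by rewrite -!mulrA !(mulrCA _ (W w)) -mulrDr ler_wpM2l//; lra.
Qed.

(** Induction on [n], with the exponential of the first [n] terms as weight [W]. The sign [s i] is
    known only from stage [i.+1] on, while [u i] and [v i] are known at stage [i]. *)
Lemma exp_supermartingale_le1 (P : probability T R) (G : nat -> set (set T))
    (s u v : nat -> T -> R) :
  (forall k, <<s G k >> `<=` measurable) ->
  (forall k, measurable_fun [set: T] (s k)) ->
  (forall k w, s k w = 1 \/ s k w = -1)%R ->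
  (forall k A, <<s G k >> A ->
     P (A `&` s k @^-1` [set 1%R]) = P A * (2^-1)%:E) ->
  (forall k A, <<s G k >> A ->
     P (A `&` s k @^-1` [set (-1)%R]) = P A * (2^-1)%:E) ->
  (forall k i, (i < k)%N ->
     measurable_fun (setT : set (g_sigma_algebraType (G k))) (s i)) ->
  (forall k i, (i <= k)%N ->
     measurable_fun (setT : set (g_sigma_algebraType (G k))) (u i)) ->
  (forall k i, (i <= k)%N ->
     measurable_fun (setT : set (g_sigma_algebraType (G k))) (v i)) ->
  (forall k w, u k w ^+ 2 <= 2 * v k w)%R ->
  forall n, \int[P]_w (expR (\sum_(i < n) (u i w * s i w - v i w)))%:E <= 1.
Proof.
move=> sG ms sE indp indm mps mpu mpv uv; elim=> [|n IH].
  under eq_integral do rewrite big_ord0 expR0.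
  by rewrite integral_cst// mul1e probability_le1.
apply: le_trans IH.
under eq_integral do rewrite big_ord_recr expRD.
apply: (ge0_integral_fair_sign_le P (G n)) => //.
- exact: indp.
- exact: indm.
- apply: measurableT_comp => //; apply: measurable_sum => i.
  apply: measurable_funB; last exact: (mpv n i (ltnW (ltn_ord i))).
  by apply: measurable_funM; [exact: (mpu n i (ltnW (ltn_ord i)))|];
    exact: (mps n i (ltn_ord i)).
- exact: mpu.
- exact: mpv.
Qed.

End Integration.

(** * The run of the algorithm *)

Section Measurability.
Context {R : realType} {d : nat} {disp : measure_display}
  {S : measurableType disp}.

(** An open set is a countable union of rational boxes, and the preimage of a box is a finite
    intersection of conditions on coordinates. Boxes not inside [V] are replaced by [set0] to keep a
    countable index type. *)
Lemma measurable_preimage_open_cV (x : S -> 'cV[R]_d) (V : set 'cV[R]_d) :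
  open V -> (forall i, measurable_fun [set: S] (fun w => x w i 0)) ->
  measurable (x @^-1` V).
Proof.
move=> oV mx.
pose box (c : 'cV[rat]_d * rat) : set 'cV[R]_d :=
  [set y | forall i, `|y i 0 - ratr (c.1 i 0)| < ratr c.2].
have -> : x @^-1` V =
    \bigcup_c (if `[< box c `<=` V >] then x @^-1` box c else set0).
  apply/seteqP; split=> [w Vw|w [c _]]; last by case: asboolP => // cV /cV.
  have /nbhs_ballP[e /= e0 eV] : nbhs (x w) V by exact: open_nbhs_nbhs.
  (* With a radius below [e / 2] and a rational centre within it of [x w], the box contains [x w]
     and stays in the ball of radius [e]. *)
  have [r /[!in_itv]/= /andP[r0 re]] : exists r, ratr r \in `]0, e / 2[.
    by apply: rat_in_itvoo; rewrite divr_gt0.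
  have /choice[q qP] : forall i, exists q,
      ratr q \in `](x w i 0 - ratr r), (x w i 0 + ratr r)[.
    by move=> i; apply: rat_in_itvoo; lra.
  exists (\col_i q i, r) => //; case: asboolP => [_ i /=|[]].
    by rewrite mxE ltr_norml; have := qP i; rewrite in_itv /= => /andP[]; lra.
  move=> y yb; apply: eV; split => // i j; rewrite ord1 /ball/=.
  have := yb i; rewrite mxE ltr_norml => /andP[y1 y2].
  have := qP i; rewrite in_itv /= => /andP[q1 q2].
  rewrite ltr_norml; lra.
apply: countable_bigcupT_measurable => [|c]; first exact: countableP.
case: asboolP => // _.
have -> : x @^-1` box c = \bigcap_(i in [set: 'I_d])
    ((fun w => x w i 0) @^-1` 
      `](ratr (c.1 i 0) - ratr c.2), (ratr (c.1 i 0) + ratr c.2)[).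
  apply/seteqP; split=> w h i.
    by rewrite /= in_itv /= -ltr_distl => _; exact: h.
  by have := h i Logic.I; rewrite /= in_itv /= -ltr_distl.
apply: fin_bigcap_measurable => // i _; rewrite -[X in measurable X]setTI.
exact: mx.
Qed.

Lemma measurable_continuous_cV (x : S -> 'cV[R]_d) (h : 'cV[R]_d -> R) :
  continuous h -> (forall i, measurable_fun [set: S] (fun w => x w i 0)) ->
  measurable_fun [set: S] (h \o x).
Proof.
move=> hc mx; apply: (measurability _ (RGenOInfty.measurableE R)).
move=> _ [_ [a ->] <-]; rewrite setTI comp_preimage.
apply: measurable_preimage_open_cV => //.
by apply: open_comp => // y _; exact: hc.
Qed.

Context (X : run R d S) (eps_g eps_H : R) (n : nat)
  (mX : forall i Y, (i <= n)%N -> predraw_var X i Y ->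
     measurable_fun [set: S] Y).

(** The sigma-algebra on [S] is arbitrary so that this serves both for the whole sample space and
    for the past of an iteration. *)
Lemma measurable_gradient_case i : (i <= n)%N ->
  measurable [set w | gradient_case X eps_g i w].
Proof.
move=> ik.
have mg : measurable_fun [set: S] (fun w => norm2 (gk X i w)).
  apply: (measurableT_comp (continuous_measurable_fun (@sqrt_continuous R))).
  apply: measurable_sum => j; apply: measurable_funX.
  by apply: mX; [exact: ik|exact: predraw_g].
have -> : [set w | gradient_case X eps_g i w] =
    [set: S] `&` (fun w => norm2 (gk X i w)) @^-1` `]eps_g, +oo[.
  by rewrite setTI; apply/seteqP; split=> w; rewrite /= in_itv /= andbT.
exact: mg.
Qed.

Lemma measurable_negative_curvature i : (i <= n)%N ->
  measurable [set w | lambda_hat X i w < - eps_H].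
Proof.
move=> ik.
have -> : [set w | lambda_hat X i w < - eps_H] =
    [set: S] `&` lambda_hat X i @^-1` `]-oo, (- eps_H)[.
  by rewrite setTI; apply/seteqP; split=> w; rewrite /= in_itv.
by apply: mX; [exact: ik|exact: predraw_lambda|..].
Qed.

Lemma measurable_stop_case i : (i <= n)%N ->
  measurable [set w | stop_case X eps_g eps_H i w].
Proof.
move=> ik; apply: measurableI; apply: measurableC.
  exact: measurable_gradient_case.
exact: measurable_negative_curvature.
Qed.

(** The range extends to [n.+1] since reaching [i] constrains only the iterations before [i]. *)
Lemma measurable_reached i : (i <= n.+1)%N ->
  measurable [set w | reached X eps_g eps_H i w].
Proof.
move=> ik.
have -> : [set w | reached X eps_g eps_H i w] =
    \bigcap_(j in [set j | (j < i)%N]) ~` [set w | stop_case X eps_g eps_H j w].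
  by apply/seteqP; split.
apply: bigcap_measurableType => j /= ji; apply: measurableC.
by apply: measurable_stop_case; rewrite -ltnS (leq_trans ji).
Qed.

Lemma measurable_terminates_at i : (i <= n)%N ->
  measurable [set w | terminates_at X eps_g eps_H i w].
Proof.
move=> ik; apply: measurableI; last exact: measurable_stop_case.
by apply: measurable_reached; exact: leqW.
Qed.

End Measurability.

Definition curvature_step {R : realType} {d : nat} {T : Type} (X : run R d T)
    (eps_g eps_H : R) (k : nat) : set T :=
  [set w | reached X eps_g eps_H k w /\ curvature_case X eps_g eps_H k w].

Definition slope {R : realType} {d : nat} {T : Type} (X : run R d T)
    (f : 'cV[R]_d -> R) (k : nat) (w : T) : R :=
  dotp (gradient f (xk X k w)) (pk X k w).

(** The first-order change of [f] at a curvature step, stripped of its sign and hence determined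
    before the draw. The indicator removes the iterations where [ak] and [pk] are unconstrained. *)
Definition drift {R : realType} {d : nat} {T : Type} (X : run R d T)
    (eps_g eps_H M : R) (f : 'cV[R]_d -> R) (k : nat) (w : T) : R :=
  \1_(curvature_step X eps_g eps_H k) w * (2 * ak X k w / M * slope X f k w).

Section MeasurableSteps.
Context {R : realType} {d : nat} {disp : measure_display}
  {S : measurableType disp}.
Context (X : run R d S) (eps_g eps_H M : R) (n : nat)
  (mX : forall i Y, (i <= n)%N -> predraw_var X i Y ->
     measurable_fun [set: S] Y).

Lemma measurable_curvature_step i : (i <= n)%N ->
  measurable (curvature_step X eps_g eps_H i).
Proof.
move=> ik; apply: measurableI.
  by apply: (measurable_reached X eps_g eps_H n mX); exact: leqW.
apply: measurableI; last exact: (measurable_negative_curvature X eps_H n mX).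
by apply: measurableC; exact: (measurable_gradient_case X eps_g n mX).
Qed.

(** The gradient is differentiable, hence continuous, so its entries at a measurable iterate are
    measurable. *)
Lemma measurable_drift (f : 'cV[R]_d -> R) i : twice_differentiable f ->
  (i <= n)%N -> measurable_fun [set: S] (drift X eps_g eps_H M f i).
Proof.
move=> hf ik; apply: measurable_funM.
  by apply: measurable_indic; exact: measurable_curvature_step.
apply: measurable_funM.
  apply: measurable_funM => //; apply: measurable_funM => //.
  by apply: mX; [exact: ik|exact: predraw_a].
apply: measurable_sum => j; apply: measurable_funM; last first.
  by apply: mX; [exact: ik|exact: predraw_p].
apply: (measurable_continuous_cV (xk X i) (fun y => gradient f y j 0)) => [y|l].
  apply: (@continuous_comp _ _ _ (gradient f) (fun v : 'cV[R]_d => v j 0)).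
    exact/differentiable_continuous/(proj2 hf).
  exact: coord_continuous.
by apply: mX; [exact: ik|exact: predraw_x].
Qed.

End MeasurableSteps.

(** * Decrease of [f] along one trajectory *)

Section Pathwise.
Context {R : realType} {d : nat} {T : Type} (f : 'cV[R]_d -> R)
  (L M eps_g eps_H alpha : R) (x0 : 'cV[R]_d) (X : run R d T).
Context (hL : 0 < L) (hM : 0 < M) (hf : twice_differentiable f)
  (hgrad : lipschitz_gradient f L) (hhess : lipschitz_hessian f M)
  (heps_g : 0 < eps_g) (heps_H : 0 < eps_H)
  (halg : follows_algorithm X eps_g eps_H L M alpha x0)
  (horacle : accurate_oracles X eps_g eps_H f)
  (hsk : forall k w, sk X k w = 1 \/ sk X k w = -1).

Lemma lambda_hatE k w :
  lambda_hat X k w = dotp (pk X k w) (Hk X k w *m pk X k w).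
Proof.
by rewrite /lambda_hat -mulmxA mxE; apply: eq_bigr => i _; rewrite mxE.
Qed.

Lemma reachedS k w : reached X eps_g eps_H k.+1 w ->
  reached X eps_g eps_H k w /\ ~ stop_case X eps_g eps_H k w.
Proof. by move=> h; split=> [i ik|]; apply: h => //; exact: ltnW. Qed.

(** The constant is the largest step [2 alpha / M] times the gradient bound [4/3 eps_g]. The
    indicator lets the variance proxy count curvature steps only. *)
Lemma sqr_drift_le k w :
  drift X eps_g eps_H M f k w ^+ 2 <=
    (8 * alpha * eps_g / (3 * M)) ^+ 2
      * \1_(curvature_step X eps_g eps_H k) w.
Proof.
rewrite /drift indicE; case: (boolP (w \in _)) => /=; last first.
  by rewrite mul0r expr0n mulr0.
rewrite inE mul1r mulr1 => -[rk ck].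
have [/andP[aH]] := (proj2 (proj2 halg)) k w rk ck.
rewrite le_min => /andP[aa _] _.
have [_ _ p1 _] := (proj2 horacle) k w rk (proj1 ck).
have gk_le : norm2 (gk X k w) <= eps_g.
  by rewrite leNgt; apply/negP; exact: (proj1 ck).
have := norm2_gradient_le f eps_g (xk X k w) _ gk_le ((proj1 horacle) k w rk).
have := abs_dotp_le_norm2 (gradient f (xk X k w)) (pk X k w).
rewrite p1 mulr1 -/(slope X f k w) => /le_trans h /h{h} sl.
have a0 : 0 < ak X k w by exact: lt_le_trans aH.
have alpha0 : 0 < alpha by exact: lt_le_trans aa.
rewrite -real_normK ?num_real//.
have c0 : 0 <= 8 * alpha * eps_g / (3 * M).
  by rewrite divr_ge0 ?mulr_ge0 ?ltW.
apply: lerXn2r; rewrite ?nnegrE// normrM.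
have s0 : 0 <= 2 * ak X k w / M by rewrite divr_ge0 ?mulr_ge0 ?ltW.
rewrite (ger0_norm s0).
have -> : 8 * alpha * eps_g / (3 * M) = 2 * alpha / M * (4 / 3 * eps_g).
  by field; rewrite lt0r_neq0.
apply: ler_pM => //.
by rewrite ler_pM2r ?invr_gt0// ler_pM2l.
Qed.

(** Reaching [k.+1] excludes a stop at [k], so the step is of one of the two kinds; the indicators
    select the matching decrease. *)
Lemma step_decrease k w : reached X eps_g eps_H k.+1 w ->
  f (xk X k.+1 w)
    + eps_g ^+ 2 / (6 * L) * (1 - \1_(curvature_step X eps_g eps_H k) w)
    + 2 * eps_H ^+ 3 / (9 * M ^+ 2) * \1_(curvature_step X eps_g eps_H k) w
  <= f (xk X k w) + drift X eps_g eps_H M f k w * sk X k w.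
Proof.
move=> /reachedS[rk nstop]; rewrite /drift indicE.
case: (boolP (w \in _)); rewrite ?inE ?notin_setE => ck /=.
  have [_ ck'] := ck.
  have [aH ->] := (proj2 (proj2 halg)) k w rk ck'.
  have [_ Herr p1 _] := (proj2 horacle) k w rk (proj1 ck').
  have := proj2 ck'; rewrite lambda_hatE => Hneg.
  move: aH; rewrite le_min lambda_hatE => /andP[a1 /andP[_ a2]].
  have := curvature_step_le f hf M eps_H (ak X k w) (sk X k w) (xk X k w) _ _
    hM heps_H hhess p1 Herr Hneg.
  rewrite a1 a2 => /(_ isT (hsk k w)).
  rewrite /slope subrr mulr0 addr0 mulr1 mul1r; lra.
rewrite subr0 mulr1 mulr0 addr0 mul0r mul0r addr0.
have gc : gradient_case X eps_g k w.
  apply: contrapT => ng; apply: nstop; split => // lam.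
  by apply: ck; split.
have -> := (proj1 (proj2 halg)) k w rk gc.
rewrite -lerBrDr; apply: gradient_step_le => //.
exact: (proj1 horacle).
Qed.

Lemma reached_decrease k w : reached X eps_g eps_H k w ->
  f (xk X k w)
    + eps_g ^+ 2 / (6 * L)
      * (k%:R - \sum_(i < k) \1_(curvature_step X eps_g eps_H i) w)
    + 2 * eps_H ^+ 3 / (9 * M ^+ 2)
      * (\sum_(i < k) \1_(curvature_step X eps_g eps_H i) w)
  <= f x0 + \sum_(i < k) drift X eps_g eps_H M f i w * sk X i w.
Proof.
elim: k => [_|k IH rk1].
  by rewrite !big_ord0 (proj1 halg) subrr !mulr0 !addr0.
have := IH (proj1 (reachedS _ _ rk1)); have := step_decrease k w rk1.
rewrite !big_ord_recr /= -natr1; lra.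
Qed.

End Pathwise.

(** * Deterministic inequalities for long runs *)

Section Arithmetic.
Context {R : realType}.

Lemma ln_inv_gt0 (delta : R) : 0 < delta < 1 -> 0 < ln (1 / delta).
Proof.
by move=> /andP[d0 d1]; rewrite ln_gt0// ltr_pdivlMr// mul1r.
Qed.

(** Both claims go by contradiction, with [r] the minimum. If [m < K], then [Z <= c m] gives [N <= D
    / Rg + (1 + c / Rg) m <= D / r + B K]. If [Z < Rh m / 2], half of the decrease survives and
    [r N <= 2 D]. *)
Lemma long_run_drift (Rg Rh c D N m Z B K : R) :
  0 < Rg -> 0 < Rh -> 0 <= c -> 0 <= D -> 0 <= m -> m <= N -> 0 <= K ->
  1 + c / Rg <= B -> Z <= c * m ->
  Rg * (N - m) + Rh * m <= D + Z ->
  2 * (D / Num.min Rg Rh) + B * K < N ->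
  K <= m /\ Rh * m / 2 <= Z.
Proof.
move=> Rg0 Rh0 c0 D0 m0 mN K0 cB Zc hdec hN.
set r := Num.min Rg Rh in hN *.
have r0 : 0 < r by rewrite lt_min Rg0.
have rg : r <= Rg by rewrite ge_min lexx.
have rh : r <= Rh by rewrite ge_min lexx orbT.
have Dr0 : 0 <= D / r by rewrite divr_ge0// ltW.
have c_Rg : 0 <= c / Rg by rewrite divr_ge0// ltW.
have BK0 : 0 <= B * K by rewrite mulr_ge0//; lra.
split; rewrite leNgt; apply/negP => h.
- have : N <= D / Rg + (1 + c / Rg) * m.
    rewrite -(ler_pM2l Rg0).
    have -> : Rg * (D / Rg + (1 + c / Rg) * m) = D + (Rg + c) * m.
      by field; lra.
    have := mulr_ge0 (ltW Rh0) m0; lra.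
  have : (1 + c / Rg) * m <= B * K by rewrite ler_pM//; lra.
  have : D / Rg <= D / r.
    by rewrite ler_wpM2l// lef_pV2.
  lra.
- have : N * r <= 2 * D.
    have : r * (N - m) <= Rg * (N - m) by rewrite ler_wpM2r// subr_ge0.
    have : r * m <= Rh * m by rewrite ler_wpM2r.
    have : 0 <= r * (N - m) by rewrite mulr_ge0 ?subr_ge0// ltW.
    lra.
  rewrite -ler_pdivlMr// -mulrA; lra.
Qed.

(* The exponent is a quadratic in the tilt [t], optimal for the drift
   [Rh * m / 2] at [t = Rh / (2 * c ^+ 2)], a value that does not depend
   on the number [m] of curvature steps. *)
Lemma tilted_drift_ge (Rh c m Z : R) : 0 < Rh -> 0 < c -> Rh * m / 2 <= Z ->
  m * (Rh ^+ 2 / (8 * c ^+ 2)) <=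
    Rh / (2 * c ^+ 2) * Z - (Rh / (2 * c ^+ 2)) ^+ 2 * c ^+ 2 / 2 * m.
Proof.
move=> Rh0 c0 hZ.
have : Rh / (2 * c ^+ 2) * (Rh * m / 2) <= Rh / (2 * c ^+ 2) * Z.
  by rewrite ler_wpM2l// divr_ge0 ?mulr_ge0 ?sqr_ge0// ltW.
have -> : (Rh / (2 * c ^+ 2)) ^+ 2 * c ^+ 2 / 2 * m =
    Rh ^+ 2 * m / (8 * c ^+ 2).
  by field; lra.
have -> : Rh / (2 * c ^+ 2) * (Rh * m / 2) = 2 * (Rh ^+ 2 * m / (8 * c ^+ 2)).
  by field; lra.
have -> : m * (Rh ^+ 2 / (8 * c ^+ 2)) = Rh ^+ 2 * m / (8 * c ^+ 2).
  by field; lra.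
lra.
Qed.

End Arithmetic.

(** * The supermartingale attached to a run *)

Section Past.
Context {R : realType} {d : nat} {disp : measure_display}
  {T : measurableType disp} (P : probability T R) (X : run R d T).

(* [past X k] is definitionally [<<s past_gen k >>]; naming the generators lets
   the past carry a [measurableType] structure. *)
Definition past_gen (k : nat) : set (set T) :=
  [set A | exists Y (B : set R),
     [/\ past_var X k Y, measurable B & A = Y @^-1` B]].

Lemma past_var_measurable k Y : past_var X k Y ->
  measurable_fun (setT : set (g_sigma_algebraType (past_gen k))) Y.
Proof.
by move=> hY _ B mB; rewrite setTI; apply: sub_sigma_algebra; exists Y, B.
Qed.

Lemma past_sub_measurable k : measurable_run X ->
  <<s past_gen k >> `<=` measurable.
Proof.
move=> [mpre ms]; apply: smallest_sub; first exact: sigma_algebra_measurable.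
move=> _ [Y [B [hY mB ->]]]; rewrite -[_ @^-1` _]setTI.
case: hY => [[i _ ->]|[i _ hY]]; first exact: ms.
exact: (mpre i Y hY).
Qed.

Lemma fair_sign_past k (b : R) A : P [set w | sk X k w = b] = (2^-1)%:E ->
  signs_independent_of_past P X -> <<s past_gen k >> A ->
  P (A `&` sk X k @^-1` [set b]) = (P A * (2^-1)%:E)%E.
Proof.
move=> hb ind hA; rewrite (ind k A [set b] hA (measurable_set1 b)).
by congr (P A * _)%E; exact: hb.
Qed.

(** The condition [u^2 <= 2 v] of the supermartingale bound is [hdrift] scaled by [lam^2]. The drift
    is measurable for the past because the measurability lemmas are instantiated at [past_gen k]. *)
Lemma exp_drift_le1 (eps_g eps_H M lam c : R) (f : 'cV[R]_d -> R) (N : nat) :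
  twice_differentiable f -> measurable_run X -> fair_signs P X ->
  signs_independent_of_past P X ->
  (forall k w, drift X eps_g eps_H M f k w ^+ 2 <=
    c ^+ 2 * \1_(curvature_step X eps_g eps_H k) w) ->
  (\int[P]_w (expR (lam * \sum_(i < N) drift X eps_g eps_H M f i w * sk X i w
     - lam ^+ 2 * c ^+ 2 / 2
       * \sum_(i < N) \1_(curvature_step X eps_g eps_H i) w))%:E <= 1)%E.
Proof.
move=> hf hmeas [hsE [hp hm]] hind hdrift.
have mpre k i Y : (i <= k)%N -> predraw_var X i Y ->
    measurable_fun (setT : set (g_sigma_algebraType (past_gen k))) Y.
  by move=> ik hY; apply: past_var_measurable; right; exists i.
have := exp_supermartingale_le1 P past_gen (sk X)
  (fun k w => lam * drift X eps_g eps_H M f k w)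
  (fun k w => lam ^+ 2 * c ^+ 2 / 2 * \1_(curvature_step X eps_g eps_H k) w).
move=> /(_ _ (proj2 hmeas) hsE) H.
have {H} := H _ _ _ _ _ _ _ N.
have E w : \sum_(i < N) (lam * drift X eps_g eps_H M f i w * sk X i w -
      lam ^+ 2 * c ^+ 2 / 2 * \1_(curvature_step X eps_g eps_H i) w) =
    lam * \sum_(i < N) drift X eps_g eps_H M f i w * sk X i w
     - lam ^+ 2 * c ^+ 2 / 2
       * \sum_(i < N) \1_(curvature_step X eps_g eps_H i) w.
  by rewrite sumrB !mulr_sumr; under eq_bigr do rewrite -mulrA.
under eq_integral do rewrite E.
apply.
- by move=> k; exact: past_sub_measurable.
- by move=> k A; exact: fair_sign_past.
- by move=> k A; exact: fair_sign_past.
- by move=> k i ik; apply: past_var_measurable; left; exists i.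
- move=> k i ik; apply: measurable_funM => //.
  exact: (@measurable_drift _ _ _ (g_sigma_algebraType (past_gen k))
    X _ _ M k (mpre k)).
- move=> k i ik; apply: measurable_funM => //; apply: measurable_indic.
  exact: (@measurable_curvature_step _ _ _ (g_sigma_algebraType (past_gen k))
    X _ _ k (mpre k)).
- move=> k w; rewrite exprMn.
  have := ler_wpM2l (sqr_ge0 lam) (hdrift k w); lra.
Qed.

End Past.

Theorem theorem2p11 (R : realType) (d : nat) (hd : (0 < d)%N)
  (f : 'cV[R]_d -> R) (L M fbar : R) (hL : 0 < L) (hM : 0 < M)
  (hf : twice_differentiable f)
  (hgrad : lipschitz_gradient f L) (hhess : lipschitz_hessian f M)
  (hfbar : forall x, fbar <= f x)
  (delta : R) (hdelta : 0 < delta < 1)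
  (eps_g eps_H alpha : R) (heps_g : 0 < eps_g) (heps_H : 0 < eps_H)
  (halpha : eps_H <= alpha <= L) (x0 : 'cV[R]_d)
  (disp : measure_display) (T : measurableType disp) (P : probability T R)
  (X : run R d T)
  (hmeas : measurable_run X)
  (halg : follows_algorithm X eps_g eps_H L M alpha x0)
  (horacle : accurate_oracles X eps_g eps_H f)
  (hsign : fair_signs P X)
  (hindep : signs_independent_of_past P X) :
  let n := iteration_bound eps_g eps_H L M alpha delta (f x0 - fbar) in
  ((1 - delta)%:E <=
     P [set w | exists2 k : nat, (k%:R <= n)%R & terminates_at X eps_g eps_H k w])%E.
Proof.
cbv zeta; set n := iteration_bound _ _ _ _ _ _ _; set E := [set w | _].
have alpha0 : 0 < alpha by case/andP: halpha => h _; exact: lt_le_trans h.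
have [delta0 delta1] := andP hdelta.
have D0 : 0 <= f x0 - fbar by rewrite subr_ge0.
pose Rg := eps_g ^+ 2 / (6 * L); pose Rh := 2 * eps_H ^+ 3 / (9 * M ^+ 2).
have Rg0 : 0 < Rg by rewrite divr_gt0 ?mulr_gt0 ?exprn_gt0.
have Rh0 : 0 < Rh by rewrite divr_gt0 ?mulr_gt0 ?exprn_gt0.
pose c := 8 * alpha * eps_g / (3 * M).
have c0 : 0 < c by rewrite divr_gt0 ?mulr_gt0.
pose C := C_const eps_g eps_H M alpha.
have C0 : 0 < C.
  by apply: mulr_gt0; [rewrite ltr0n|rewrite divr_gt0 ?mulr_gt0 ?exprn_gt0].
pose K := K_const eps_g eps_H L M alpha delta (f x0 - fbar).
pose B := B_const eps_g L M alpha.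
have KC : C * ln (1 / delta) <= K.
  by apply: ler_wpM2l; [exact: ltW|rewrite le_max lexx].
have K0 : 0 < K.
  by apply: lt_le_trans KC; rewrite mulr_gt0// ln_inv_gt0.
have c_Rg : 1 + c / Rg <= B.
  (* The ratio is [16 alpha L / (M eps_g)], below the coefficient 18 in [B]. *)
  have -> : c / Rg = 16 * (alpha * L / (M * eps_g)).
    by rewrite /c /Rg; field; rewrite !lt0r_neq0.
  have -> : B = 1 + 18 * (alpha * L / (M * eps_g)).
    by rewrite /B /B_const; field; rewrite !lt0r_neq0.
  have : 0 < alpha * L / (M * eps_g) by rewrite divr_gt0 ?mulr_gt0.
  lra.
have nE : n = 2 * ((f x0 - fbar) / Num.min Rg Rh) + B * K by [].
have n0 : 0 <= n.
  have h1 : 0 < Num.min Rg Rh by rewrite lt_min Rg0.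
  have h2 : 0 <= c / Rg by rewrite divr_ge0// ltW.
  by rewrite nE addr_ge0// mulr_ge0 ?divr_ge0 ?(ltW K0)// ?(ltW h1)//; lra.
(* The least natural number above [n]: [k < N] is equivalent to [k <= n], so a run outside [E] makes
   at least [N] updates. *)
pose N := (Num.truncn n).+1.
have nN : n < N%:R by exact: real_truncnS_gt (num_real n).
pose Z w := \sum_(i < N) drift X eps_g eps_H M f i w * sk X i w.
pose m w : R := \sum_(i < N) \1_(curvature_step X eps_g eps_H i) w.
pose lam := Rh / (2 * c ^+ 2).
pose W w := expR (lam * Z w - lam ^+ 2 * c ^+ 2 / 2 * m w).
have hdrift k w : drift X eps_g eps_H M f k w ^+ 2 <=
    c ^+ 2 * \1_(curvature_step X eps_g eps_H k) w.
  exact: (sqr_drift_le f L M eps_g eps_H alpha x0).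
have EW : (\int[P]_w (W w)%:E <= 1)%E by exact: exp_drift_le1.
have mpre i Y : (i <= N)%N -> predraw_var X i Y -> measurable_fun [set: T] Y.
  by move=> _; exact: (proj1 hmeas).
have mW : measurable_fun [set: T] W.
  apply: measurableT_comp => //; apply: measurable_funB.
    apply: measurable_funM => //; apply: measurable_sum => i.
    apply: measurable_funM; last exact: (proj2 hmeas).
    by apply: (measurable_drift X eps_g eps_H M N mpre) => //; exact: ltnW.
  apply: measurable_funM => //; apply: measurable_sum => i.
  apply: measurable_indic.
  by apply: (measurable_curvature_step X eps_g eps_H N mpre); exact: ltnW.
have mE : measurable E.
  have -> : E = \bigcup_(k in [set k : nat | k%:R <= n])
      [set w | terminates_at X eps_g eps_H k w].
    by apply/seteqP; split=> w [k kn kw]; exists k.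
  apply: bigcup_measurable => k /= kn.
  apply: (measurable_terminates_at X eps_g eps_H N mpre).
  by rewrite -(ler_nat R) (le_trans kn)// ltW.
have W_ge w : ~ E w -> 1 / delta <= W w.
  move=> nEw.
  have reach k : (k <= N)%N -> reached X eps_g eps_H k w.
    elim: k => [//|k IH kN] i; rewrite ltnS leq_eqVlt => /predU1P[->|ik].
      move=> stop; apply: nEw; exists k; last by split=> //; exact/IH/ltnW.
      by rewrite -truncn_ge_nat// -ltnS.
    by apply: IH ik; exact: ltnW.
  have := reached_decrease f L M eps_g eps_H alpha x0 X hL hM hf hgrad hhess
    heps_g heps_H halg horacle (proj1 hsign) N w (reach N (leqnn N)).
  rewrite -/Rg -/Rh -/(m w) -/(Z w) => hdec.
  have m0 : 0 <= m w by apply: sumr_ge0 => i _; rewrite indicE.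
  have mN : m w <= N%:R.
    rewrite -[N in leRHS]card_ord -sum1_card natr_sum.
    by apply: ler_sum => i _; rewrite indicE lern1 leq_b1.
  have Zc : Z w <= c * m w.
    rewrite mulr_sumr; apply: ler_sum => i _.
    (* An indicator equals its square, so the bound on squared drifts yields one on absolute
       values. *)
    have sq1 : \1_(curvature_step X eps_g eps_H i) w ^+ 2 =
        \1_(curvature_step X eps_g eps_H i) w :> R.
      by rewrite indicE; case: (w \in _); rewrite ?expr1n ?expr0n.
    rewrite (le_trans (ler_norm _))// normrM.
    have -> : `|sk X i w| = 1.
      by have [->|->] := (proj1 hsign) i w; rewrite ?normrN normr1.
    have c1 : 0 <= c * \1_(curvature_step X eps_g eps_H i) w.
      by rewrite mulr_ge0 ?(ltW c0)// indicE.
    rewrite mulr1 -ler_sqr ?nnegrE// real_normK ?num_real// (exprMn _ c) sq1.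
    exact: hdrift.
  have [||] := long_run_drift Rg Rh c (f x0 - fbar) N%:R (m w) (Z w) B K
    Rg0 Rh0 (ltW c0) D0 m0 mN (ltW K0) c_Rg Zc.
  - by have := hfbar (xk X N w); lra.
  - by rewrite -nE.
  move=> Km hZ; rewrite -[leLHS]lnK ?posrE ?divr_gt0// /W ler_expR.
  apply: le_trans (tilted_drift_ge Rh c (m w) (Z w) Rh0 c0 hZ).
  (* This identity accounts for 2304 in [C]. With [m >= K >= C ln (1 / delta)] the exponent is at
     least [2 ln (1 / delta)]. *)
  have -> : Rh ^+ 2 / (8 * c ^+ 2) = 2 / C.
    by rewrite /Rh /c /C /C_const; field; rewrite !lt0r_neq0.
  rewrite mulrA ler_pdivlMr//.
  have := ln_inv_gt0 delta hdelta; move: KC.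
  set l := ln _ => KC l0; have := mulr_gt0 l0 C0; lra.
have mEC : measurable (~` E) by exact: measurableC.
(* Markov: [P (~] E) / delta[is at most the integral of]W[over]~[E], hence at most 1. *)
have PE : (P (~` E) <= delta%:E)%E.
  have mWE : measurable_fun [set: T] (EFin \o W) by exact/measurable_EFinP.
  have : ((1 / delta)%:E * P (~` E) <= 1)%E.
    apply: le_trans EW; rewrite -integral_cst//.
    apply: (@le_trans _ _ (\int[P]_(w in ~` E) (W w)%:E)%E).
      apply: ge0_le_integral => //.
      - by move=> w _; rewrite lee_fin divr_ge0// ltW.
      - exact: measurable_funTS.
    by apply: ge0_subset_integral => // w _; rewrite lee_fin expR_ge0.
  have Pfin : P (~` E) \is a fin_num by exact: fin_num_measure.
  by rewrite -(fineK Pfin) -EFinM !lee_fin mul1r mulrC ler_pdivrMr// mul1r.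
rewrite -[E]setCK probability_setC; last exact: mEC.
by rewrite EFinB leeB.
Qed.
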